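(* Let $R$ be an almost perfect domain with field of quotients $Q\neq R$. The following are equivalent for an $R$-module $M$: (1) $M$ is divisible; (2) $\mathrm{rad}({}_RM)=M$ (i.e. $M$ has no maximal $R$-submodules); (3) $\mathfrak{m}M=M$ for every $\mathfrak{m}\in\mathrm{Max}(R)$.
   Context: All rings are commutative with $1\neq 0$ and all modules are unital. A ring is perfect if every module over it has a projective cover. An almost perfect domain is an integral domain $R$ such that $R/I$ is perfect for every non-zero proper ideal $I$. $M$ is divisible if $rM=M$ for every $0\neq r\in R$. $\mathrm{Max}(R)$ is the set of maximal ideals of $R$. $\mathrm{rad}({}_RM)$ is the intersection of all maximal submodules of $M$ (and equals $M$ if there are none). *)

(* Defs.v *)
From HB Require Import structures.
From mathcomp Require Import all_boot all_order all_algebra.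
From mathcomp Require Import ring_quotient fraction.
From mathcomp Require Import boolp classical_sets.
Set Implicit Arguments.
Unset Strict Implicit.
Unset Printing Implicit Defensive.
Import GRing.Theory.
Local Open Scope classical_set_scope.
Local Open Scope ring_scope.

(* Membership in [idealr R] and [submodClosed M] is boolean; with [boolp] every
   Prop-valued predicate is of that form, so these types comprise all proper
   ideals of R and all submodules of M. *)

Section ProjectiveCovers.
Variable A : comNzRingType.

Definition projective (P : lmodType A) : Prop :=
  forall (X Y : lmodType A) (g : {linear X -> Y}) (f : {linear P -> Y}),
    range g = [set: Y] -> exists h : {linear P -> X}, g \o h =1 f.

Definition superfluous (P : lmodType A) (K : set P) : Prop :=
  forall N : submodClosed P,
    [set x + y | x in [set` N] & y in K] = [set: P] -> [set` N] = [set: P].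

Definition is_projective_cover (X P : lmodType A) (f : {linear P -> X}) : Prop :=
  [/\ projective P, range f = [set: X] & superfluous [set x | f x = 0]].

Definition perfect_ring : Prop :=
  forall X : lmodType A,
    exists (P : lmodType A) (f : {linear P -> X}), is_projective_cover f.

End ProjectiveCovers.

(* [idealr R] consists of the proper ideals: its elements do not contain 1. *)
Definition almost_perfect_domain (R : idomainType) : Prop :=
  forall I : idealr R, (exists2 x : R, x \in I & x != 0) ->
    perfect_ring {ideal_quot I}.

Definition Max (R : comNzRingType) : set (idealr R) :=
  [set m | forall I : idealr R, {subset m <= I} -> {subset I <= m}].

Section Modules.
Variables (R : comNzRingType) (M : lmodType R).

Definition divisible : Prop :=
  forall r : R, r != 0 -> [set r *: x | x in [set: M]] = [set: M].

Definition maximal_submodule (N : submodClosed M) : Prop :=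
  [set` N] <> [set: M] /\
  forall L : submodClosed M, {subset N <= L} ->
    [set` L] = [set` N] \/ [set` L] = [set: M].

(* The intersection of the empty family is [set: M]. *)
Definition module_rad : set M :=
  \bigcap_(N in [set N | maximal_submodule N]) [set` N].

Definition ideal_mul_module (I : idealr R) : set M :=
  [set x | exists n (a : 'I_n -> R) (y : 'I_n -> M),
     (forall i, a i \in I) /\ x = \sum_(i < n) a i *: y i].

End Modules.
Arguments divisible {R} M.
Arguments module_rad {R} M.
Arguments ideal_mul_module {R} M I.

(* Main.v *)
Require Import Defs.
From HB Require Import structures.
From mathcomp Require Import all_boot all_order all_algebra.
From mathcomp Require Import ring_quotient fraction.
From mathcomp Require Import boolp classical_sets.
From mathcomp Require Import generic_quotient freeg.
Set Implicit Arguments.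
Unset Strict Implicit.
Unset Printing Implicit Defensive.
Import GRing.Theory.
Local Open Scope classical_set_scope.
Local Open Scope ring_scope.

(** If [M] is divisible and [N] is a maximal submodule, pick a nonzero nonunit
    [r]. The simple module [M / N] is killed by a nonzero scalar: by [r], or
    else by [1 - b r], where [b] is a scalar such that [r] and [b] act on a
    generator of [M / N] as mutually inverse. But [M / N] is divisible, hence
    zero ([divisible_no_maximal]).

    If [m] is maximal and [x] lies outside [mM], then a submodule containing
    [mM] and maximal among those avoiding [x] is a maximal submodule, because
    [M / mM] is a vector space over the field [R / m]
    ([rad_full_mul_module]).

    Finally suppose [mM = M] for all maximal [m], and let [r] be a nonzero
    nonunit. Then [X = M / rM] is a module over the perfect ring
    [A = R / (r)], and it satisfies [mX = X] for all maximal ideals [m] of [A];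
    one has to show [X = 0] ([perfect_eq0]). Take a projective cover [P] of
    [X], with superfluous kernel [K]. From [mX = X] one gets [mP + K = P],
    hence [mP = P]. A projective module with this property is zero, by the
    determinant trick ([projective_eq0]): split the canonical surjection onto
    [P] from the free module on the elements of [P]. For [x] in [P], the
    coordinates [c] of the lift of [x] satisfy [c = c B], where the matrix [B]
    has its entries in every maximal ideal. So [det (1 - B)] kills [c] and lies
    in no maximal ideal: it is a unit, [c = 0] and [x = 0]. *)

(** * Submodules and ideals from closed sets *)

Lemma submodule_of_set (R : comNzRingType) (V : lmodType R) (X : set V) :
  X 0 -> (forall a u v, X u -> X v -> X (a *: u + v)) ->
  exists N : submodClosed V, forall x, x \in N <-> X x.
Proof.
move=> X0 XD; pose S : V -> bool := fun x => `[< X x >].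
have subS : subsemimod_closed S.
  split; [split|].
  - exact/asboolP.
  - move=> u v /asboolP Xu /asboolP Xv; apply/asboolP.
    by rewrite -[u]scale1r; apply: XD.
  - move=> a u /asboolP Xu; apply/asboolP.
    by rewrite -[_ *: _]addr0; apply: XD.
pose NS := GRing.isSubmodClosed.Build R V S subS.
pose N : submodClosed V := HB.pack S NS.
by exists N => x; split => /asboolP.
Qed.

Lemma ideal_of_set (R : comNzRingType) (X : set R) :
  X 0 -> ~ X 1 -> (forall a u v, X u -> X v -> X (a * u + v)) ->
  exists I : idealr R, forall x, x \in I <-> X x.
Proof.
move=> X0 X1 XD; pose S : R -> bool := fun x => `[< X x >].
have clS : idealr_closed S.
  split; first exact/asboolP.
  - exact/asboolPn.
  - by move=> a u v /asboolP Xu /asboolP Xv; apply/asboolP/XD.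
pose IS := isIdealr.Build R S clS.
pose I : idealr R := HB.pack S IS.
by exists I => x; split => /asboolP.
Qed.

(** Zorn's lemma is applied to sets that contain [N0] only if they are nonempty,
    so that the union of the empty chain is admissible too. *)
Lemma submodule_avoiding (R : comNzRingType) (V : lmodType R)
    (N0 : submodClosed V) (x : V) :
  x \notin N0 ->
  exists N : submodClosed V, [/\ {subset N0 <= N}, x \notin N &
    forall L : submodClosed V,
      {subset N <= L} -> x \notin L -> {subset L <= N}].
Proof.
move=> xN0.
pose P (Y : set V) := [/\ Y !=set0 -> [set` N0] `<=` Y, ~ Y x &
  forall a u v, Y u -> Y v -> Y (a *: u + v)].
have PN (N : submodClosed V) : {subset N0 <= N} -> x \notin N -> P [set` N].
  move=> sN xN; split=> [_ z /sN //||a u v /= Nu Nv]; first exact/negP.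
  by rewrite rpredD // rpredZ.
have [F FP Ftot|Y [[Y0 Yx YD] Ymax]] := @Zorn_bigcup V P.
  split=> [[z [X FX Xz]] y N0y|[X FX Xx]|a u v [X FX Xu] [Z FZ Zv]].
  - by exists X => //; have [XN _ _] := FP _ FX; apply: XN => //; exists z.
  - by have [_ nXx _] := FP _ FX; exact: nXx.
  - have [XZ|ZX] := Ftot _ _ FX FZ.
    + by exists Z => //; have [_ _ ZD] := FP _ FZ; apply: ZD => //; apply: XZ.
    + by exists X => //; have [_ _ XD] := FP _ FX; apply: XD => //; apply: ZX.
have {Y0}N0Y : [set` N0] `<=` Y.
  apply: Y0; apply: contrapT => /set0P/negP/negPn/eqP Y0.
  apply: (Ymax [set` N0]); last exact: PN.
  rewrite Y0; split; first by move=> z.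
  by move=> /(_ 0 (rpred0 N0)).
have [N NY] := @submodule_of_set R V Y (N0Y _ (rpred0 N0)) YD.
exists N; split=> [z /N0Y Yz||L NL xL z Lz]; first exact/NY.
  by apply/negP => /NY.
apply: contrapT => Nz; apply: (Ymax [set` L]).
  split; first by move=> y /NY/NL.
  by move=> /(_ z Lz)/NY.
by apply: PN => // y /N0Y/NY/NL.
Qed.

(** * Maximal ideals *)

(** Together with its converse [Max_of_inverse], this says that maximality of
    [m] amounts to every nonzero element of [R / m] being invertible; this form
    transfers to quotient rings without comparing lattices of ideals. *)
Lemma Max_inverse (R : comNzRingType) (m : idealr R) (a : R) :
  Max m -> a \notin m -> exists b, 1 - b * a \in m.
Proof.
move=> mmax am; apply: contrapT => nb.
pose X : set R := [set x | exists2 u, u \in m & exists b, x = u + b * a].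
have [||c u v [u' mu [b ->]] [v' mv [d ->]]|I IX] := @ideal_of_set R X.
- by exists 0; [exact: rpred0 | exists 0; rewrite mul0r addr0].
- move=> [u mu [b e]]; apply: nb; exists b.
  by rewrite e addrK.
- exists (c * u' + v'); first by rewrite rpredD // idealMr.
  by exists (c * b + d); rewrite mulrDr mulrDl addrACA mulrA.
have mI : {subset m <= I}.
  by move=> u mu; apply/IX; exists u => //; exists 0; rewrite mul0r addr0.
move/negP: am; apply; apply: (mmax I mI); apply/IX.
by exists 0; [exact: rpred0 | exists 1; rewrite mul1r add0r].
Qed.

Lemma Max_of_inverse (R : comNzRingType) (m : idealr R) :
  (forall a, a \notin m -> exists b, 1 - b * a \in m) -> Max m.
Proof.
move=> inv I mI a Ia; apply/negPn/negP => /inv[b /mI Ib].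
have : 1 \in I by rewrite -[1](subrK (b * a)) rpredD // idealMr.
by rewrite idealr1.
Qed.

(** Ideals are the submodules of the regular module, and an ideal is proper iff
    it avoids 1; so this is an instance of [submodule_avoiding]. *)
Lemma nonunit_in_Max (R : comNzRingType) (d : R) :
  (forall b, b * d != 1) -> exists2 m : idealr R, Max m & d \in m.
Proof.
move=> dnu.
have [||N0 N0d] := @submodule_of_set R R^o [set x | exists b, x = b * d].
- by exists 0; rewrite mul0r.
- move=> a u v [b ->] [c ->]; exists (a * b + c).
  by rewrite mulrDl -mulrA.
have [|N [N0N N1 Nmax]] := @submodule_avoiding R R^o N0 1.
  by apply/negP => /N0d[b]/esym/eqP; apply/negP.
have [||a u v Nu Nv|m mN] := @ideal_of_set R [set` N].
- exact: rpred0.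
- exact/negP.
- by rewrite /= rpredD // (rpredZ a).
exists m; last by apply/mN/N0N/N0d; exists 1; rewrite mul1r.
move=> I mI a Ia; apply/mN.
have [|b u v Iu Iv|L LI] := @submodule_of_set R R^o [set` I].
- exact: idealr0.
- by rewrite /= rpredD // (idealMr b).
apply: (Nmax L); last exact/LI.
- by move=> u /mN/mI/LI.
- by apply/negP => /LI; rewrite /= idealr1.
Qed.

(** The inverse image of a maximal ideal under the surjection from [R] to
    [R / I] is maximal, since inverses modulo [m] lift along the surjection. *)
Lemma Max_quotient (R : comNzRingType) (I : idealr R)
    (m : idealr {ideal_quot I}) :
  Max m -> exists2 n : idealr R, Max n &
    forall a, a \in n = (\pi_{ideal_quot I}%qT a \in m).
Proof.
move=> mmax.
pose piI : {rmorphism R -> {ideal_quot I}} := \pi_{ideal_quot I}%qT.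
have [|/=|a u v /= mu mv|n nE] := @ideal_of_set R [set a | piI a \in m].
- by rewrite /= rmorph0 idealr0.
- by rewrite rmorph1 idealr1.
- by rewrite rmorphD rmorphM rpredD // idealMr.
have {}nE a : (a \in n) = (piI a \in m) by apply/idP/idP => /nE.
exists n => //; apply: Max_of_inverse => a; rewrite nE.
move=> /(Max_inverse mmax)[b].
rewrite -[b]reprK -(rmorph1 piI) -rmorphM -rmorphB -nE => bn.
by exists (repr b).
Qed.

(** * The submodule generated by the products of an ideal and a module *)

Lemma mul_module_submodule (R : comNzRingType) (M : lmodType R) (I : idealr R) :
  exists N : submodClosed M, forall x, x \in N <-> ideal_mul_module M I x.
Proof.
apply: submodule_of_set.
  by exists 0%N, (fun=> 0), (fun=> 0); split; [case | rewrite big_ord0].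
move=> c _ _ [k [a [y [Ia ->]]]] [l [b [z [Ib ->]]]].
pose f T (s : 'I_k -> T) (t : 'I_l -> T) i :=
  match fintype.split i with inl i => s i | inr i => t i end.
exists (k + l)%N, (f _ (fun i => c * a i) b), (f _ y z); split.
  by move=> i; rewrite /f; case: fintype.split => j //; rewrite idealMr.
rewrite big_split_ord scaler_sumr /f; congr (_ + _); apply: eq_bigr => i _.
- rewrite scalerA; case: (splitP (lshift l i)) => j /= e.
    by have -> : j = i by exact: val_inj.
  by move: (ltn_ord i); rewrite e ltnNge leq_addr.
- case: (splitP (rshift k i)) => j /= e; last first.
    by have -> : j = i by apply/val_inj/(@addnI k).
  by move: (ltn_ord j); rewrite -e ltnNge leq_addr.
Qed.

Lemma mem_mul_module (R : comNzRingType) (M : lmodType R) (I : idealr R)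
    a (x : M) :
  a \in I -> ideal_mul_module M I (a *: x).
Proof.
by move=> Ia; exists 1%N, (fun=> a), (fun=> x); split=> //; rewrite big_ord1.
Qed.

(** * Projective modules that equal their product with each maximal ideal *)

Lemma fglift_linear (R : comNzRingType) (M : lmodType R) (K : choiceType)
    (f : K -> M) :
  linear (fglift f : {freeg K / R} -> M).
Proof.
have addf : forall D E, fglift f (D + E) = fglift f D + fglift f E.
  have fB := lift_is_additive f.
  have f0 : fglift f 0 = 0 by rewrite -(subrr 0) fB subrr.
  have fN D : fglift f (- D) = - fglift f D.
    by rewrite -[in LHS](sub0r D) fB f0 sub0r.
  by move=> D E; rewrite -[in LHS](opprK E) fB fN opprK.
have f0 : fglift f 0 = 0 by apply: (addrI (fglift f 0)); rewrite -addf !addr0.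
move=> c D E; rewrite addf; congr (_ + _).
rewrite -[in RHS](freeg_sumE D) !(big_morph (fglift f) addf f0) scaler_sumr.
by apply: eq_bigr => z _; rewrite !liftU scalerA.
Qed.

Lemma coeff_mul_module (A : comNzRingType) (m : idealr A) (P : lmodType A)
    (K : choiceType) (h : {linear P -> {freeg K / A}}) (z : K) (p : P) :
  ideal_mul_module P m p -> coeff z (h p) \in m.
Proof.
move=> [n [a [y [ma ->]]]]; rewrite linear_sum raddf_sum rpred_sum // => i _.
by rewrite linearZ /= coeffZ mulrC idealMr.
Qed.

(** Modulo [m] the matrix [1 - B] becomes the identity, of determinant 1. *)
Lemma det_1sub_mod (A : comNzRingType) (m : idealr A) n (B : 'M[A]_n) :
  (forall i j, B i j \in m) -> \det (1%:M - B) \notin m.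
Proof.
move=> mB; pose pim : {rmorphism A -> {ideal_quot m}} := \pi_{ideal_quot m}%qT.
have pim0 a : (a \in m) = (pim a == 0).
  by rewrite -[0](rmorph0 pim) -Quotient.idealrBE subr0.
rewrite pim0 -det_map_mx map_mxB map_mx1.
have -> : map_mx pim B = 0.
  by apply/matrixP => i j; rewrite !mxE; apply/eqP; rewrite -pim0.
by rewrite subr0 det1 oner_eq0.
Qed.

(** This is the determinant trick of Nakayama's lemma. It applies although [P]
    need not be finitely generated, because a section [h] of the surjection from
    the free module on [P] writes each [x] over a finite support, and the images
    under [h] of that support can be truncated to the same support. *)
Lemma projective_eq0 (A : comNzRingType) (P : lmodType A) :
  projective P ->
  (forall m : idealr A, Max m -> ideal_mul_module P m = [set: P]) ->
  forall x : P, x = 0.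
Proof.
move=> projP mP x.
pose F := {freeg P / A}.
have linF := @fglift_linear A P P id.
pose FL := GRing.isLinear.Build A F P *:%R (fglift id) linF.
pose ev : {linear F -> P} := HB.pack (fglift id : F -> P) FL.
have [|h hK] := projP F P ev idfun.
  by apply/seteqP; split=> // p _; exists << p >> => //=; rewrite liftU scale1r.
pose s := dom (h x); pose n := size s.
pose c : 'rV[A]_n := \row_i coeff s`_i (h x).
pose B : 'M[A]_n := \matrix_(i, j) coeff s`_j (h s`_i).
(* [c] lists the coordinates of [h x] on its support. *)
have xE : x = \sum_(i < n) c 0 i *: s`_i.
  have xE : ev (h x) = x := hK x.
  rewrite -[LHS]xE -[h x in LHS]freeg_sumE (linear_sum ev) (big_nth 0).
  rewrite big_mkord.
  by apply: eq_bigr => i _; rewrite mxE; apply: liftU.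
(* Apply [h] to the expansion of [x] and compare coefficients at each [s`_j]. *)
have cB : c *m (1%:M - B) = 0.
  apply/eqP; rewrite mulmxBr mulmx1 subr_eq0; apply/eqP/rowP => j.
  rewrite !mxE {1}xE linear_sum raddf_sum; apply: eq_bigr => i _.
  by rewrite linearZ /= coeffZ !mxE.
have [b /eqP detB] : exists b, b * \det (1%:M - B) == 1.
  apply: contrapT => nex.
  have [b|m mmax] := @nonunit_in_Max A (\det (1%:M - B)).
    by apply/negP => be; apply: nex; exists b.
  apply/negP/det_1sub_mod => i j; rewrite mxE; apply: coeff_mul_module.
  by rewrite mP.
have c0 : c = 0.
  rewrite -[c]scale1r -detB -scalerA -[X in b *: X]mul_mx_scalar.
  by rewrite -mul_mx_adj mulmxA cB mul0mx scaler0.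
by rewrite xE c0 big1 // => i _; rewrite mxE scale0r.
Qed.

(** Since [f] maps [mP] onto [mX = X], the submodules [mP] and [ker f] generate
    [P]; as [ker f] is superfluous, [mP = P], and [projective_eq0] applies. *)
Lemma perfect_eq0 (A : comNzRingType) (X : lmodType A) :
  perfect_ring A ->
  (forall m : idealr A, Max m -> ideal_mul_module X m = [set: X]) ->
  forall x : X, x = 0.
Proof.
move=> /(_ X)[P [f [projP fsurj fsup]]] mX x.
have [p _ <-] : range f x by rewrite fsurj.
suff -> : p = 0 by rewrite linear0.
apply: projective_eq0 => // m mmax.
have [N NE] := mul_module_submodule P m.
have {}NE : [set` N] = ideal_mul_module P m by apply/seteqP; split=> y /NE.
rewrite -NE; apply: fsup; apply/seteqP; split=> // q _.
have [n [a [y [ma fq]]]] : ideal_mul_module X m (f q) by rewrite mX.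
have /choice[z zE] : forall i, exists z, f z = y i.
  move=> i; have [z _ zy] : range f (y i) by rewrite fsurj.
  by exists z.
have Nq : ideal_mul_module P m (\sum_i a i *: z i) by exists n, a, z.
exists (\sum_i a i *: z i); first by rewrite NE.
exists (q - \sum_i a i *: z i); last by rewrite subrKC.
rewrite /= linearB /= fq linear_sum; apply/eqP; rewrite subr_eq0; apply/eqP.
by apply: eq_bigr => i _; rewrite linearZ /= zE.
Qed.

(** * The quotient of a module, over the quotient of its ring *)

Section QuotientModule.
Variables (R : comNzRingType) (I : idealr R).
Variables (M : lmodType R) (N : submodClosed M).
Hypothesis IM : forall a x, a \in I -> a *: x \in N.

(** A copy of [N] that can carry the structure of a predicate closed under
    opposites, which the quotient construction requires. *)
Definition submodule_pred : {pred M} := fun x => x \in N.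

Fact submodule_pred_zmod : zmod_closed submodule_pred.
Proof.
split=> [|x y Nx Ny]; first exact: (rpred0 N).
by rewrite -scaleN1r; apply: (@rpredD _ N) => //; apply: (rpredZ (-1)).
Qed.
HB.instance Definition _ :=
  GRing.isZmodClosed.Build M submodule_pred submodule_pred_zmod.

Local Notation Q := (Quotient.quot submodule_pred).
Local Notation A := {ideal_quot I}.

Definition quot_scale (a : A) (x : Q) : Q := \pi_Q%qT (repr a *: repr x).

Lemma quot_modE x y : (\pi_Q%qT x == \pi_Q%qT y) = (x - y \in N).
Proof. by rewrite -Quotient.idealrBE. Qed.

Lemma quot_scale_pi a x :
  quot_scale (\pi_A%qT a) (\pi_Q%qT x) = \pi_Q%qT (a *: x).
Proof.
apply/eqP; rewrite quot_modE.
set b := repr _; set y := repr _.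
have Ib : b - a \in I by rewrite Quotient.idealrBE reprK.
have Ny : y - x \in N by rewrite -quot_modE reprK.
have -> : b *: y - a *: x = (b - a) *: y + a *: (y - x).
  by rewrite scalerBl scalerBr addrA subrK.
by apply: rpredD; [exact: IM | exact: rpredZ].
Qed.

Fact quot_scaleA a b x : quot_scale a (quot_scale b x) = quot_scale (a * b) x.
Proof.
elim/quotW: a => a; elim/quotW: b => b; elim/quotW: x => x.
rewrite -(rmorphM (\pi_A%qT)).
by rewrite (quot_scale_pi b) !quot_scale_pi scalerA.
Qed.

Fact quot_scale1 x : quot_scale 1 x = x.
Proof.
by elim/quotW: x => x; rewrite -(rmorph1 (\pi_A%qT)) quot_scale_pi scale1r.
Qed.

Fact quot_scaleDr : right_distributive quot_scale +%R.
Proof.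
move=> a x y; elim/quotW: a => a; elim/quotW: x => x; elim/quotW: y => y.
rewrite -(raddfD (\pi_Q%qT)).
by rewrite !quot_scale_pi scalerDr (raddfD (\pi_Q%qT)).
Qed.

Fact quot_scaleDl x : {morph quot_scale^~ x : a b / a + b}.
Proof.
move=> a b; elim/quotW: a => a; elim/quotW: b => b; elim/quotW: x => x.
rewrite -(rmorphD (\pi_A%qT)).
by rewrite !quot_scale_pi scalerDl (raddfD (\pi_Q%qT)).
Qed.

Lemma quotient_module_over : exists (X : lmodType A) (p : {additive M -> X}),
  [/\ forall x, exists y, x = p y, forall a x, p (a *: x) = \pi_A%qT a *: p x &
      forall x, p x = 0 -> x \in N].
Proof.
pose XL := GRing.Zmodule_isLmodule.Build A Q
  quot_scaleA quot_scale1 quot_scaleDr quot_scaleDl.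
pose X : lmodType A := HB.pack Q XL.
exists X, (\pi_Q%qT : {additive M -> Q}); split=> /=.
- by move=> x; exists (repr (x : Q)); rewrite reprK.
- by move=> a x; rewrite -quot_scale_pi.
- by move=> x /eqP; rewrite -(raddf0 (\pi_Q%qT)) quot_modE subr0.
Qed.

End QuotientModule.

(** * The three implications *)

Lemma exists_nonunit (R : idomainType) :
  range (@FracField.tofrac R) <> [set: {fraction R}] ->
  exists2 r : R, r != 0 & r \isn't a GRing.unit.
Proof.
move=> hQ; apply: contrapT => allU; apply: hQ; apply/seteqP; split=> // q _.
elim/quotW: q => -[[n d] /= d0].
have Ud : d \is a GRing.unit.
  by apply/negPn/negP => dU; apply: allU; exists d.
exists (n * d^-1) => //=; rewrite [LHS]piE; apply/eqmodP => /=.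
rewrite /FracField.equivf numden_Ratio ?oner_eq0 //=.
by rewrite numden_Ratio ?oner_eq0 //= mul1r divrK.
Qed.

Lemma submodule_add_line (R : comNzRingType) (M : lmodType R)
    (N : submodClosed M) (x : M) :
  exists L : submodClosed M, [/\ {subset N <= L}, x \in L &
    forall y, y \in L -> exists2 u, u \in N & exists a, y = u + a *: x].
Proof.
have [|c _ _ [u Nu [a ->]] [v Nv [b ->]]|L LE] := @submodule_of_set R M
    [set y | exists2 u, u \in N & exists a, y = u + a *: x].
- by exists 0; [exact: rpred0 | exists 0; rewrite scale0r addr0].
- exists (c *: u + v); first by rewrite rpredD // rpredZ.
  by exists (c * a + b); rewrite scalerDr scalerDl addrACA scalerA.
exists L; split=> [u Nu||y /LE //]; apply/LE.
- by exists u => //; exists 0; rewrite scale0r addr0.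
- by exists 0; [exact: rpred0 | exists 1; rewrite scale1r add0r].
Qed.

Lemma maximal_submodule_span (R : comNzRingType) (M : lmodType R)
    (N : submodClosed M) (x : M) :
  maximal_submodule N -> x \notin N ->
  forall y, exists2 u, u \in N & exists a, y = u + a *: x.
Proof.
move=> [_ Nmax] xN y; have [L [NL Lx LE]] := submodule_add_line N x.
have [LN|LT] := Nmax L NL.
  by move/negP: xN; have : [set` L] x by []; rewrite LN.
by apply/LE; have : [set: M] y by []; rewrite -LT.
Qed.

(** Some nonzero [s] maps [x] into [N], hence [M = N + R x] into [N], which
    contradicts [s M = M]. *)
Lemma divisible_no_maximal (R : idomainType) (M : lmodType R) (r : R)
    (N : submodClosed M) :
  r != 0 -> r \isn't a GRing.unit -> divisible M -> ~ maximal_submodule N.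
Proof.
move=> r0 rU divM Nmax.
have [x xN] : exists x, x \notin N.
  apply: contrapT => nx; case: Nmax => NM _; apply: NM.
  by apply/seteqP; split=> // y _; apply/negPn/negP => yN; apply: nx; exists y.
have [s s0 sxN] : exists2 s, s != 0 & s *: x \in N.
  have [rxN|rxN] := boolP (r *: x \in N); first by exists r.
  (* [s = 1 - b r] is nonzero because [r] is not a unit. *)
  have [u Nu [b xE]] := maximal_submodule_span Nmax rxN x.
  exists (1 - b * r); last by rewrite scalerBl scale1r -scalerA {1}xE addrK.
  apply/negP; rewrite subr_eq0 => /eqP br; move/negP: rU; apply.
  by apply/unitrP; exists b; rewrite (mulrC r).
move/negP: (xN); apply.
have [y _ <-] : [set s *: y | y in [set: M]] x by rewrite divM.
have [u Nu [a ->]] := maximal_submodule_span Nmax xN y.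
by rewrite scalerDr scalerA mulrC -scalerA rpredD // rpredZ.
Qed.

(** A submodule [N] that contains [mM] and is maximal among those avoiding [x]
    is a maximal submodule: for [y] outside [N], [x] is in [N + R y] with a
    coefficient of [y] that is invertible modulo [m], hence modulo [N] the
    element [y] is a multiple of [x]. *)
Lemma rad_full_mul_module (R : comNzRingType) (M : lmodType R) (m : idealr R) :
  Max m -> module_rad M = [set: M] -> ideal_mul_module M m = [set: M].
Proof.
move=> mmax radM; have [N0 N0E] := mul_module_submodule M m.
apply/seteqP; split=> // x _; apply/N0E/negPn/negP => /submodule_avoiding.
case=> N [N0N xN Nmax].
have mMN a y : a \in m -> a *: y \in N.
  by move=> ma; apply/N0N/N0E/mem_mul_module.
have Nmaximal : maximal_submodule N.
  split=> [NT|L NL].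
    by move/negP: xN; apply; have : [set: M] x by []; rewrite -NT.
  have [xL|xL] := boolP (x \in L); last first.
    by left; apply/seteqP; split=> y; [exact: Nmax | exact: NL].
  right; apply/seteqP; split=> // y _ /=.
  have [/NL //|yN] := boolP (y \in N).
  have [L' [NL' L'y L'E]] := submodule_add_line N y.
  have xL' : x \in L'.
    by apply/negPn/negP => xL'; move/negP: yN; apply; apply: Nmax L'y.
  have [u Nu [a xE]] := L'E _ xL'.
  have am : a \notin m.
    apply/negP => ma; move/negP: xN; apply.
    by rewrite xE rpredD // mMN.
  have [b mb] := Max_inverse mmax am.
  have -> : y = (1 - b * a) *: y + (b *: x + (- b) *: u).
    rewrite xE scalerDr scalerA scalerBl scale1r scaleNr.
    by rewrite [b *: u + _]addrC addrK subrK.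
  apply: rpredD; first exact/NL/mMN.
  by apply: rpredD; apply: rpredZ => //; exact: NL.
have : module_rad M x by rewrite radM.
by move=> /(_ N Nmaximal); apply/negP.
Qed.

(** For a nonunit [r], the equality [rM = M] says that the module [M / rM] over
    the perfect ring [R / (r)] is zero, which is [perfect_eq0]. *)
Lemma divisible_of_mul_module (R : idomainType) (M : lmodType R) :
  almost_perfect_domain R ->
  (forall m : idealr R, Max m -> ideal_mul_module M m = [set: M]) ->
  divisible M.
Proof.
move=> hR mM r r0; apply/seteqP; split=> // x _.
have [rU|rU] := boolP (r \is a GRing.unit).
  by exists (r^-1 *: x) => //; rewrite scalerA divrr // scale1r.
have [||a _ _ [b ->] [c ->]|I IE] := @ideal_of_set R
    [set a | exists b, a = b * r].
- by exists 0; rewrite mul0r.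
- move=> [b br]; move/negP: rU; apply; apply/unitrP; exists b.
  by rewrite (mulrC r) -br.
- by exists (a * b + c); rewrite mulrDl mulrA.
have [|a _ _ [y ->] [z ->]|N NE] := @submodule_of_set R M
    [set x | exists y, x = r *: y].
- by exists 0; rewrite scaler0.
- by exists (a *: y + z); rewrite scalerDr !scalerA mulrC.
have IN a y : a \in I -> a *: y \in N.
  by move=> /IE[b ->]; apply/NE; exists (b *: y); rewrite scalerA mulrC.
have [X [p [psurj pZ pN]]] := quotient_module_over IN.
suff X0 : forall y : X, y = 0.
  by have /NE[y ->] := pN x (X0 _); exists y.
apply: perfect_eq0.
  by apply: hR; exists r => //; apply/IE; exists 1; rewrite mul1r.
move=> m mmax; apply/seteqP; split=> // y _.
have [n nmax nE] := Max_quotient mmax.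
have [z ->] := psurj y.
have [k [a [w [na ->]]]] : ideal_mul_module M n z by rewrite mM.
exists k, (fun i => \pi_{ideal_quot I}%qT (a i)), (fun i => p (w i)).
split=> [i|]; first by rewrite -nE.
by rewrite raddf_sum; apply: eq_bigr.
Qed.

Theorem proposition3p6 (R : idomainType)
    (hR : almost_perfect_domain R)
    (hQ : range (@FracField.tofrac R) <> [set: {fraction R}])
    (M : lmodType R) :
  [<-> divisible M;
       module_rad M = [set: M];
       forall m : idealr R, Max m -> ideal_mul_module M m = [set: M]].
Proof.
have [r r0 rU] := exists_nonunit hQ.
tfae.
- move=> divM; apply/seteqP; split=> // x _ N /= Nmax.
  by case: (divisible_no_maximal r0 rU divM Nmax).
- by move=> radM m mmax; apply: rad_full_mul_module.
- exact: divisible_of_mul_module.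
Qed.
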